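(* Let $A$ be an artin algebra. The poset of $\omega$-torsion pairs of $\operatorname{mod} A$ is a finite distributive lattice.
   Context: An artin algebra is an algebra that is finitely generated as a module over a commutative artinian ring. $\operatorname{mod} A$ denotes the category of finitely generated right $A$-modules. Subcategories are full and closed under isomorphisms. A torsion pair of $\operatorname{mod} A$ is a pair $(\mathcal{T},\mathcal{F})$ of subcategories such that (1) $\operatorname{Hom}_A(T,F)=0$ for all $T\in\mathcal{T}$, $F\in\mathcal{F}$; (2) for every $X\in\operatorname{mod} A$ there is a short exact sequence $0\to t(X)\to X\to f(X)\to 0$ with $t(X)\in\mathcal{T}$ and $f(X)\in\mathcal{F}$. An $\omega$-torsion pair (also called $\omega_1$-torsion pair) is a torsion pair $(\mathcal{T},\mathcal{F})$ such that $\operatorname{Ext}^1_A(T,F)=0$ for all $T\in\mathcal{T}$, $F\in\mathcal{F}$. The $\omega$-torsion pairs are ordered by $(\mathcal{T}_1,\mathcal{F}_1)\leq(\mathcal{T}_2,\mathcal{F}_2)$ if and only if $\mathcal{T}_1\subseteq\mathcal{T}_2$ (equivalently $\mathcal{F}_2\subseteq\mathcal{F}_1$). *)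

(* Defs.v *)
From HB Require Import structures.
From mathcomp Require Import all_boot all_order all_algebra.
Set Implicit Arguments.
Unset Strict Implicit.
Unset Printing Implicit Defensive.
Import GRing.Theory.
Local Open Scope ring_scope.

Definition ideal (R : comPzRingType) (I : R -> Prop) : Prop :=
  [/\ I 0, (forall x y, I x -> I y -> I (x + y))
    & (forall a x, I x -> I (a * x))].

Definition artinian (R : comPzRingType) : Prop :=
  forall I : nat -> R -> Prop,
    (forall n, ideal (I n)) ->
    (forall n x, I n.+1 x -> I n x) ->
    exists n, forall m, (n <= m)%N -> forall x, I n x -> I m x.

(* The algebra structure over R is given by a ring morphism with central image
   rather than by [algType R], because the latter excludes the zero ring. *)
Definition artin_algebra (A : pzRingType) : Prop :=
  exists (R : comPzRingType) (phi : {rmorphism R -> A}),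
    [/\ artinian R,
        (forall r a, phi r * a = a * phi r)
      & exists (n : nat) (g : 'I_n -> A), forall a, exists c : 'I_n -> R,
          a = \sum_(i < n) phi (c i) * g i].

Definition finitely_generated (B : pzRingType) (M : lmodType B) : Prop :=
  exists (n : nat) (g : 'I_n -> M), forall x, exists c : 'I_n -> B,
    x = \sum_(i < n) c i *: g i.

Record fgmod (B : pzRingType) := FgMod {
  fgmod_sort :> lmodType B;
  fgmod_fg : finitely_generated fgmod_sort
}.

(* Right A-modules are left modules over the converse ring A^c. *)
Definition modcat (A : pzRingType) := fgmod A^c.

Section Extensions.
Variable B : pzRingType.

Definition isomorphic (M N : lmodType B) : Prop :=
  exists f : {linear M -> N}, bijective f.

(* 0 -> L -> M -> N -> 0 *)
Definition short_exact (L M N : lmodType B)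
    (i : {linear L -> M}) (p : {linear M -> N}) : Prop :=
  [/\ injective i, (forall z, exists y, p y = z)
    & forall y, p y = 0 <-> exists x, i x = y].

(* Ext^1(N, L) is taken in the sense of Yoneda: its elements are the short
   exact sequences 0 -> L -> E -> N -> 0 up to equivalence, and its zero is the
   class of the split sequence. *)
Record extension (N L : lmodType B) := Extension {
  ext_mid :> lmodType B;
  ext_in : {linear L -> ext_mid};
  ext_out : {linear ext_mid -> N};
  ext_exact : short_exact ext_in ext_out
}.

Definition ext_equiv (N L : lmodType B) (xi eta : extension N L) : Prop :=
  exists h : {linear xi -> eta},
    (forall x, h (ext_in xi x) = ext_in eta x) /\
    (forall y, ext_out eta (h y) = ext_out xi y).

Section Split.
Variables N L : lmodType B.

Definition split_in (x : L) : (L * N)%type := (x, 0).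
Definition split_out (y : (L * N)%type) : N := y.2.

Fact split_in_linear : linear split_in.
Proof. by move=> a x y; congr pair; rewrite /= scaler0 addr0. Qed.
HB.instance Definition _ :=
  GRing.isLinear.Build B L (L * N)%type _ split_in split_in_linear.

Fact split_out_linear : linear split_out.
Proof. by []. Qed.
HB.instance Definition _ :=
  GRing.isLinear.Build B (L * N)%type N _ split_out split_out_linear.

Fact split_exact : short_exact split_in split_out.
Proof.
split=> [x y [] //|z|[x z]]; first by exists (0, z).
by split=> /= [zE|[y [_ <-]] //]; exists x; rewrite /split_in -zE.
Qed.

Definition split_extension : extension N L := Extension split_exact.
End Split.

Definition Ext1_zero (N L : lmodType B) : Prop :=
  forall xi : extension N L, ext_equiv xi (split_extension N L).

Definition Hom_zero (M N : lmodType B) : Prop :=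
  forall (f : {linear M -> N}) (x : M), f x = 0.

End Extensions.

Section TorsionPairs.
Variable A : pzRingType.

Definition iso_closed (C : modcat A -> Prop) : Prop :=
  forall M N : modcat A, isomorphic M N -> C M -> C N.

Definition torsion_pair (T F : modcat A -> Prop) : Prop :=
  [/\ iso_closed T, iso_closed F,
      (forall X Y : modcat A, T X -> F Y -> Hom_zero X Y)
    & forall X : modcat A, exists (tX fX : modcat A)
        (i : {linear tX -> X}) (p : {linear X -> fX}),
        [/\ short_exact i p, T tX & F fX]].

Record omega_torsion_pair := OmegaTorsionPair {
  torsion_class : modcat A -> Prop;
  torsionfree_class : modcat A -> Prop;
  otp_torsion_pair : torsion_pair torsion_class torsionfree_class;
  otp_Ext1_zero : forall X Y : modcat A,
    torsion_class X -> torsionfree_class Y -> Ext1_zero X Y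
}.

Definition otp_le (x y : omega_torsion_pair) : Prop :=
  forall X : modcat A, torsion_class x X -> torsion_class y X.

End TorsionPairs.

(* Main.v *)
From HB Require Import structures.
Require Import Defs.
From mathcomp Require Import all_boot all_order all_algebra.
From mathcomp Require Import boolp.

(** Write B for the converse ring A^c, so that right A-modules are left
    B-modules.  An element e of B is called left semicentral when
    b e = e b e for all b; then e is idempotent and eB is a two-sided ideal.
    The theorem holds because omega-torsion pairs are the same thing as such
    idempotents, taken up to eB = fB, and these form a finite distributive
    lattice.

    From e one gets the pair T = {X | e x = x for all x},
    F = {X | e x = 0 for all x}, with torsion submodule eX; a module E with
    submodule in F and quotient in T splits because y |-> y - e y is linear on
    E ([idempotent_otp]).  Conversely, let (T, F) be an omega-torsion pair and
    let I be the torsion part of B.  The vanishing of Ext^1 makes F closed under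
    quotients ([torsionfree_class_quotient]), so for x in X in T the module
    Bx/Ix, a quotient of B/I, lies in F; it is a submodule of X/Ix with quotient
    X/Bx in T, hence a direct summand of the torsion module X/Ix, hence zero.
    Thus x lies in Ix ([mem_torsion_ideal_scale]).  Applied to X = I, and
    because I is finitely generated over the centre, this yields one e in I
    acting as a left identity on I; it is left semicentral and it recovers T
    and F ([otp_semicentral_idempotent]).

    The order becomes e <= f iff f e = e.  Meets are given by e f, joins by
    e + f - e f, and distributivity is a computation.  Since B is left
    noetherian, the ideals eB satisfy the ascending chain condition; so do the
    left annihilators of the idempotents, which is the descending chain condition
    for the order.  A distributive lattice with both chain conditions is finite
    ([all_down_finite]).

    Finitely generated modules must be noetherian for submodules to stay in
    the category; this rests on the fact that a commutative artinian ring is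
    noetherian ([artinian_noetherian]). *)

Set Implicit Arguments.
Unset Strict Implicit.
Unset Printing Implicit Defensive.
Import Order.TTheory GRing.Theory.
Local Open Scope ring_scope.
Local Open Scope quotient_scope.

(** * Finitely generated submodules and noetherian rings *)

Section Submodules.
Variables (R : pzRingType) (V : lmodType R).
Implicit Types (U W : V -> Prop) (s t : seq V).

Definition submodule U : Prop :=
  [/\ U 0, (forall x y, U x -> U y -> U (x + y)) & (forall a x, U x -> U (a *: x))].

Lemma submoduleB U x y : submodule U -> U x -> U y -> U (x - y).
Proof. by case=> _ UD UZ Ux Uy; apply: UD => //; rewrite -scaleN1r; apply: UZ. Qed.

Lemma submoduleI U W : submodule U -> submodule W -> submodule (fun x => U x /\ W x).
Proof.
move=> [U0 UD UZ] [W0 WD WZ]; split=> // [x y [Ux Wx] [Uy Wy]|a x [Ux Wx]].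
  by split; [apply: UD|apply: WD].
by split; [apply: UZ|apply: WZ].
Qed.

Fixpoint spanned s : V -> Prop :=
  if s is v :: s' then fun x => exists a, spanned s' (x - a *: v) else fun x => x = 0.

Lemma spanned_submodule s : submodule (spanned s).
Proof.
elim: s => [|v s [s0 sD sZ]] /=.
  by split=> // [x y -> ->|a x ->]; rewrite ?addr0 ?scaler0.
split=> [|x y [a sa] [b sb]|b x [a sa]].
- by exists 0; rewrite scale0r subr0.
- by exists (a + b); rewrite scalerDl opprD addrACA; apply: sD.
by exists (b * a); rewrite -scalerA -scalerBr; apply: sZ.
Qed.

Lemma mem_spanned s x : x \in s -> spanned s x.
Proof.
elim: s => //= v s IHs; rewrite inE => /predU1P[->|/IHs sx].
  by exists 1; rewrite scale1r subrr; case: (spanned_submodule s).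
by exists 0; rewrite scale0r subr0.
Qed.

Lemma spanned_min U s : submodule U -> (forall x, x \in s -> U x) ->
  forall x, spanned s x -> U x.
Proof.
move=> Us; elim: s => [|v s IHs] sU x /=; first by move->; case: Us.
move=> [a] /IHs sa; rewrite -(subrK (a *: v) x); case: Us => _ UD UZ.
apply: UD; first by apply: sa => y sy; apply: sU; rewrite inE sy orbT.
by apply/UZ/sU/mem_head.
Qed.

Lemma spanned_sub s t : {subset s <= t} -> forall x, spanned s x -> spanned t x.
Proof.
by move=> st; apply: spanned_min (spanned_submodule t) _ => x /st; apply: mem_spanned.
Qed.

Definition fingen U : Prop := exists s, forall x, U x <-> spanned s x.

Definition noetherian_on U : Prop :=
  forall W, submodule W -> (forall x, W x -> U x) -> fingen W.

Lemma fingen_mem U s : submodule U -> (forall x, x \in s -> U x) ->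
  (forall x, U x -> spanned s x) -> fingen U.
Proof. by move=> Us sU Uspan; exists s; split; [apply: Uspan|apply: spanned_min]. Qed.

End Submodules.

(** Linear relations are used rather than linear maps because, for U inside
    Rv + span s, the v-coefficient of an element of U is not a function of it. *)
Section LinearRelation.
Variables (R : pzRingType) (V W : lmodType R) (U : V -> Prop) (rho : V -> W -> Prop).
Hypotheses (U_submodule : submodule U).
Hypotheses (rho0 : rho 0 0).
Hypotheses (rhoD : forall x y v w, rho x v -> rho y w -> rho (x + y) (v + w)).
Hypotheses (rhoZ : forall a x v, rho x v -> rho (a *: x) (a *: v)).
Hypotheses (rho_total : forall x, U x -> exists w, rho x w).

Lemma linear_relation_image : submodule (fun w => exists x, U x /\ rho x w).
Proof.
have [U0 UD UZ] := U_submodule.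
split=> [|v w [x [Ux xv]] [y [Uy yw]]|a v [x [Ux xv]]].
- by exists 0.
- by exists (x + y); split; [apply: UD|apply: rhoD].
by exists (a *: x); split; [apply: UZ|apply: rhoZ].
Qed.

Lemma linear_relation_kernel : submodule (fun x => U x /\ rho x 0).
Proof.
apply: submoduleI => //; split=> // [x y x0 y0|a x x0].
  by rewrite -[X in rho _ X](addr0 0); apply: rhoD.
by rewrite -[X in rho _ X](scaler0 _ a); apply: rhoZ.
Qed.

Lemma lift_span s : (forall w, w \in s -> exists x, U x /\ rho x w) ->
  exists t, (forall x, x \in t -> U x) /\
    forall w, spanned s w -> exists x, spanned t x /\ rho x w.
Proof.
elim: s => [|v s IHs] sP.
  by exists [::]; split=> // w ->; exists 0.
have [w sw|t [tU tP]] := IHs; first by apply: sP; rewrite inE sw orbT.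
have [x [Ux xv]] := sP v (mem_head _ _).
exists (x :: t); split=> [y|w /= [a /tP[y [ty yw]]]].
  by rewrite inE => /predU1P[->|/tU].
exists (y + a *: x); split; first by exists a; rewrite addrK.
by rewrite -(subrK (a *: v) w); apply: rhoD => //; apply: rhoZ.
Qed.

(** The analogue for relations of: an extension of two finitely generated
    modules is finitely generated. *)
Lemma fingen_linear_relation :
  fingen (fun w => exists x, U x /\ rho x w) ->
  fingen (fun x => U x /\ rho x 0) -> fingen U.
Proof.
move=> [s sP] [t tP].
have [|u [uU uP]] := @lift_span s; first by move=> w /mem_spanned /sP.
apply: (@fingen_mem _ _ _ (u ++ t)) => // [x|x Ux].
  by rewrite mem_cat => /orP[/uU|/mem_spanned /tP[]].
have [w xw] := rho_total Ux.
have /sP/uP[y [uy yw]]: exists x, U x /\ rho x w by exists x.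
rewrite -(subrK y x); have [_ sD _] := spanned_submodule (u ++ t).
apply: sD; last by apply: spanned_sub uy => z zu; rewrite mem_cat zu.
suff /tP : U (x - y) /\ rho (x - y) 0.
  by apply: spanned_sub => z zt; rewrite mem_cat zt orbT.
split; first by apply: submoduleB => //; apply: spanned_min uy.
by rewrite -(subrr w) -!scaleN1r; apply/rhoD/rhoZ.
Qed.

End LinearRelation.

Definition noetherian (R : pzRingType) (V : lmodType R) : Prop :=
  noetherian_on (fun _ : V => True).

(** Induction on the generators: the possible coefficients of the first
    generator form an ideal, and what remains lies in the span of the others. *)
Lemma spanned_noetherian (R : pzRingType) (V : lmodType R) (s : seq V) :
  noetherian R^o -> noetherian_on (spanned s).
Proof.
move=> Rn; elim: s => [|v s IHs] U Us Uspan.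
  exists [::] => x; split; first exact: Uspan.
  by move=> ->; case: Us.
pose rho (x : V) (a : R^o) := spanned s (x - (a : R) *: v).
have [s0 sD sZ] := spanned_submodule s.
have rho0 : rho 0 0 by rewrite /rho scale0r subr0.
have rhoD x y a b : rho x a -> rho y b -> rho (x + y) (a + b).
  by rewrite /rho scalerDl opprD addrACA; apply: sD.
have rhoZ a x b : rho x b -> rho (a *: x) (a *: b).
  by move=> xb; rewrite /rho -[_ *: v]scalerA -scalerBr; apply: sZ.
apply: (fingen_linear_relation (rho := rho)) => //.
  by apply: Rn => //; apply: linear_relation_image.
apply: IHs; first exact: linear_relation_kernel.
by move=> x [_]; rewrite /rho scale0r subr0.
Qed.

Lemma ascending_chain (R : pzRingType) (V : lmodType R) (U : nat -> V -> Prop) :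
  noetherian V -> (forall n, submodule (U n)) ->
  (forall n x, U n x -> U n.+1 x) ->
  exists n, forall x, U n.+1 x -> U n x.
Proof.
move=> Vn Us UP.
have U_le m n x : (m <= n)%N -> U m x -> U n x.
  elim: n => [|n IHn]; first by rewrite leqn0 => /eqP->.
  by rewrite leq_eqVlt => /predU1P[->//|/IHn mn /mn]; apply: UP.
have [||s sP] := Vn (fun x => exists n, U n x) => //.
  split=> [|x y [m Ux] [n Uy]|a x [n Ux]].
  - by exists 0%N; case: (Us 0%N).
  - exists (maxn m n); case: (Us (maxn m n)) => _ UD _.
    by apply: UD; [apply: U_le Ux|apply: U_le Uy]; rewrite ?leq_maxl ?leq_maxr.
  by exists n; case: (Us n) => _ _; apply.
have [n nP] : exists n, forall x, x \in s -> U n x.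
  have: forall x, x \in s -> exists n, U n x by move=> x /mem_spanned /sP.
  elim: s {sP} => [|v s IHs] sP; first by exists 0%N.
  have [x sx|n nP] := IHs; first by apply: sP; rewrite inE sx orbT.
  have [m Um] := sP v (mem_head _ _).
  exists (maxn m n) => x; rewrite inE => /predU1P[->|/nP Un].
    by apply: U_le Um; rewrite leq_maxl.
  by apply: U_le Un; rewrite leq_maxr.
exists n => x Ux; apply: spanned_min (Us n) nP _ _.
by apply/sP; exists n.+1.
Qed.

(** Dependent choice turns the chain condition into the minimum condition. *)
Lemma minimal_of_chains (T : Type) (le : T -> T -> Prop) :
  (forall x : nat -> T, (forall n, le (x n.+1) (x n)) ->
     exists n, le (x n) (x n.+1)) ->
  forall P : T -> Prop, (exists x, P x) ->
  exists x, P x /\ forall y, P y -> le y x -> le x y.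
Proof.
move=> chain P [x0 Px0]; apply: contrapT => nomin.
have next (u : {x | P x}) : exists v : {x | P x},
    le (sval v) (sval u) /\ ~ le (sval u) (sval v).
  case: u => x Px; apply: contrapT => nonext; apply: nomin; exists x.
  split=> // y Py yx; apply: contrapT => nxy; apply: nonext.
  by exists (exist _ y Py).
have [f fP] := choice next.
have [n|n] := chain (fun n => sval (iter n f (exist _ x0 Px0))).
  exact: (fP _).1.
exact: (fP _).2.
Qed.

(** Two properties of an ideal I that behaves like a vector space: every scalar
    with xI = I is invertible on I, and if every scalar acts on I as zero or
    invertibly then I is noetherian. *)
Section ArtinianNoetherian.
Variables (R : comPzRingType) (I : R^o -> Prop).
Hypotheses (R_artinian : artinian R) (I_submodule : submodule I).

(** The chain of the ideals x^n R stops, which gives x^n = x^(n+1) a; as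
    x^n I = I, the scalar a inverts x on I. *)
Lemma scalar_inverse x :
  (forall y, I y -> exists z, I z /\ y = x * z) ->
  exists a, forall y, I y -> a * (x * y) = y.
Proof.
move=> xI.
have [|n r [a ->]|n /(_ n.+1 (leqnSn n) (x ^+ n))] :=
    R_artinian (I := fun n r => exists a, r = x ^+ n * a).
- move=> n; split=> [|r s [a ->] [b ->]|a r [b ->]].
  + by exists 0; rewrite mulr0.
  + by exists (a + b); rewrite mulrDr.
  by exists (a * b); rewrite mulrCA.
- by exists (x * a); rewrite exprSr mulrA.
case=> [|a xa]; first by exists 1; rewrite mulr1.
exists a => y Iy.
have xnI m z : I z -> exists w, I w /\ z = x ^+ m * w.
  elim: m z => [|m IHm] z Iz; first by exists z; rewrite mul1r.
  have [w [Iw ->]] := xI z Iz; have [u [Iu ->]] := IHm w Iw.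
  by exists u; rewrite exprS mulrA.
have [z [Iz ->]] := xnI n y Iy.
by rewrite [in RHS]xa exprS -!mulrA mulrCA [a * (_ * z)]mulrCA.
Qed.

(** If some W in I were not finitely generated, one could pick v_0, v_1, ... in
    W with v_n outside the span of its predecessors.  Independence over a field
    makes the spans of the tails v_n, v_(n+1), ... strictly descending. *)
Lemma homogeneous_noetherian :
  (forall x y, I y -> x * y != 0 -> exists a, forall z, I z -> a * (x * z) = z) ->
  noetherian_on I.
Proof.
move=> inv W Ws WI; apply: contrapT => Wfg.
pose T := {s : seq R^o | forall x, x \in s -> W x}.
have next (s : T) : exists v, W v /\ ~ spanned (sval s) v.
  case: s => s sW; apply: contrapT => nonext; apply: Wfg.
  apply: (fingen_mem Ws sW) => x Wx; apply: contrapT => Nx.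
  by apply: nonext; exists x.
have [f fP] := choice next.
have consW (s : T) x : x \in f s :: sval s -> W x.
  by rewrite inE => /predU1P[->|/(svalP s)//]; apply: (fP s).1.
have nilW (x : R^o) : x \in [::] -> W x by [].
pose L n : T := iter n (fun s => exist _ (f s :: sval s) (@consW s)) (exist _ [::] nilW).
pose v n := f (L n).
have vL i j : (i < j)%N -> v i \in sval (L j).
  elim: j => // j IHj; rewrite ltnS leq_eqVlt inE.
  by case/predU1P=> [->|/IHj->]; rewrite ?eqxx ?orbT.
pose C n x := exists k, spanned [seq v i | i <- iota n k] x.
have C_le n k l x : (k <= l)%N -> spanned [seq v i | i <- iota n k] x ->
    spanned [seq v i | i <- iota n l] x.
  move=> kl; apply: spanned_sub; apply: sub_map => i; rewrite !mem_iota.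
  by case/andP=> -> /leq_trans-> //; rewrite leq_add2l.
have [|n x [k Cx]|n /(_ n.+1 (leqnSn n) (v n))] := R_artinian (I := C).
- move=> n; split=> [|x y [k Cx] [l Cy]|a x [k Cx]].
  + by exists 0%N.
  + exists (maxn k l).
    have [_ sD _] := spanned_submodule [seq v i | i <- iota n (maxn k l)].
    by apply: sD; [apply: C_le Cx|apply: C_le Cy]; rewrite ?leq_maxl ?leq_maxr.
  exists k; have [_ _ sZ] := spanned_submodule [seq v i | i <- iota n k].
  exact: (sZ a).
- exists k.+1; apply: spanned_sub Cx; apply: sub_map => i; rewrite !mem_iota.
  by rewrite addSnnS => /andP[/ltnW-> ->].
case; first by exists 1%N; apply: mem_spanned; rewrite inE.
elim=> [/=|k IHk].
  move=> v0; case: (fP (L n)) => _; case; rewrite -/(v n) v0.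
  by case: (spanned_submodule (sval (L n))).
rewrite -[k.+1]addn1 iotaD map_cat /=; set t := map _ _; set j := (n.+1 + k)%N => vn.
have [a at_] : spanned (v j :: t) (v n).
  by apply: spanned_sub vn => x; rewrite mem_cat inE orbC.
(* The last coefficient in a relation expressing v n by later terms is either
   zero on v j, or invertible and then v j depends on its predecessors. *)
have [av0|/inv] := eqVneq (a * v j) 0.
  by apply: IHk; move: at_; rewrite -[a *: _]/(a * v j) av0 subr0.
case=> [|b bP]; first exact/WI/(fP _).1.
apply: (fP (L j)).2; rewrite -/(v j) -[v j]bP; last exact/WI/(fP _).1.
have tL x : x \in t -> x \in sval (L j).
  by case/mapP=> i; rewrite mem_iota => /andP[_ ij] ->; apply: vL.
have [_ _ sZ] := spanned_submodule (sval (L j)).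
apply: (sZ b); rewrite -[a * v j](subKr (v n)).
apply: submoduleB (spanned_submodule _) _ _.
  by apply/mem_spanned/vL; rewrite ltnS leq_addr.
exact: spanned_sub tL _ at_.
Qed.

End ArtinianNoetherian.

(** Take I minimal among the ideals that are not noetherian.  For a scalar x,
    if both xI and the annihilator of x in I were proper in I they would be
    noetherian, and so would I; hence xI = 0 or xI = I, and I is like a vector
    space. *)
Theorem artinian_noetherian (R : comPzRingType) : artinian R -> noetherian R^o.
Proof.
move=> Ra; apply: contrapT => Rn.
pose T := {J : R^o -> Prop | submodule J}.
have chain (J : nat -> T) : (forall n x, sval (J n.+1) x -> sval (J n) x) ->
    exists n, forall x, sval (J n) x -> sval (J n.+1) x.
  move=> JP; have [n nP] := Ra (fun n => sval (J n)) (fun n => svalP (J n)) JP.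
  by exists n; apply: nP.
have Ts : submodule (fun _ : R^o => True) by [].
have [|[I Is] [/= In Imin]] := minimal_of_chains
    (le := fun J K : T => forall x, sval J x -> sval K x) chain
    (P := fun J => ~ noetherian_on (sval J)).
  by exists (exist _ _ Ts).
have proper J : submodule J -> (forall x, J x -> I x) ->
    ~ (forall x, I x -> J x) -> noetherian_on J.
  move=> Js JI nIJ; apply: contrapT => Jn; apply: nIJ.
  exact: (Imin (exist _ J Js)).
apply: (In); apply: homogeneous_noetherian => // x y Iy xy0.
apply: scalar_inverse => //; apply: contrapT => xI; apply: In => W Ws WI.
pose rho (u v : R^o) := v = x * u :> R.
have rho0 : rho 0 0 by rewrite /rho mulr0.
have rhoD u v u' v' : rho u u' -> rho v v' -> rho (u + v) (u' + v').
  by rewrite /rho => -> ->; rewrite mulrDr.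
have rhoZ a u v : rho u v -> rho (a *: u) (a *: v).
  by rewrite /rho => ->; rewrite -[LHS]/(a * (x * u)) mulrCA.
have xI_sub := linear_relation_image Is rho0 rhoD rhoZ.
have ann_sub := linear_relation_kernel Is rho0 rhoD rhoZ.
apply: (fingen_linear_relation (rho := rho)) => //.
- by move=> u _; exists (x * u).
- apply: (proper _ xI_sub).
  + by move=> _ [u [Iu ->]]; case: Is => _ _ IZ; apply: (IZ x).
  + by move=> h; apply: xI => z /h.
  + exact: linear_relation_image.
  by move=> v [u [/WI Iu uv]]; exists u.
apply: (proper _ ann_sub).
- by move=> u [].
- by move=> /(_ y Iy) [_ /esym/eqP]; apply/negP.
- exact: linear_relation_kernel.
by move=> u [/WI].
Qed.

(** * Submodules and quotients as modules *)

Section LinearMaps.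
Variables (B : pzRingType) (M N : lmodType B) (f : M -> N) (f_linear : linear f).
HB.instance Definition _ := GRing.isLinear.Build B M N _ f f_linear.
Lemma linear_packing : exists g : {linear M -> N}, g =1 f.
Proof. by exists f. Qed.
End LinearMaps.

Lemma surjection_factor (B : pzRingType) (M N L : lmodType B)
    (p : {linear M -> N}) (f : {linear M -> L}) :
  (forall z, exists y, p y = z) -> (forall x, p x = 0 -> f x = 0) ->
  exists g : {linear N -> L}, forall x, g (p x) = f x.
Proof.
move=> /choice[r rP] pf.
have gp x : f (r (p x)) = f x.
  by apply/eqP; rewrite -subr_eq0 -linearB; apply/eqP/pf; rewrite linearB rP subrr.
have g_linear : linear (fun z => f (r z)).
  by move=> a y z; rewrite -linearP -(gp (a *: _ + _)) linearP !rP.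
by have [g gE] := linear_packing g_linear; exists g => x; rewrite gE.
Qed.

Lemma injection_lift (B : pzRingType) (M N L : lmodType B)
    (i : {linear N -> M}) (f : {linear L -> M}) :
  injective i -> (forall x, exists y, i y = f x) ->
  exists g : {linear L -> N}, forall x, i (g x) = f x.
Proof.
move=> i_inj /choice[g gP].
have g_lin : linear g by move=> a x y; apply: i_inj; rewrite linearP !gP linearP.
by have [h hE] := linear_packing g_lin; exists h => x; rewrite hE.
Qed.

Section SubmoduleObject.
Variables (B : pzRingType) (M : lmodType B) (U : M -> Prop).
Hypothesis U_submodule : submodule U.

Definition submodule_pred : {pred M} := fun x => `[<U x>].

Lemma submodule_predP x : reflect (U x) (x \in submodule_pred).
Proof. exact: asboolP. Qed.

Fact submodule_pred_closed : subsemimod_closed submodule_pred.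
Proof.
have [U0 UD UZ] := U_submodule.
split; first split=> [|x y /submodule_predP Ux /submodule_predP Uy].
- exact/submodule_predP.
- exact/submodule_predP/UD.
by move=> a x /submodule_predP Ux; apply/submodule_predP/UZ.
Qed.
HB.instance Definition _ :=
  GRing.isSubmodClosed.Build B M submodule_pred submodule_pred_closed.

Record submodule_type := SubmoduleType {
  submodule_val :> M;
  submodule_valP : submodule_val \in submodule_pred
}.
HB.instance Definition _ := [isSub for submodule_val].
HB.instance Definition _ := [Choice of submodule_type by <:].
HB.instance Definition _ := [SubChoice_isSubLmodule of submodule_type by <:].

Lemma submodule_object : exists (N : lmodType B) (i : {linear N -> M}),
  injective i /\ forall x, U x <-> exists y, i y = x.
Proof.
exists (submodule_type : lmodType B), (val : {linear submodule_type -> M}).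
split=> [|x]; first exact: val_inj.
split=> [/submodule_predP Ux|[y <-]]; first by exists (SubmoduleType Ux).
exact/submodule_predP/valP.
Qed.

Local Notation Q := (Quotient.quot submodule_pred).

Definition quotient_scale (a : B) (x : Q) : Q := \pi_Q (a *: repr x).

Lemma quotient_scale_pi a x : quotient_scale a (\pi_Q x) = \pi_Q (a *: x).
Proof.
apply/eqP; rewrite -Quotient.idealrBE -scalerBr.
have [_ _ UZ] := U_submodule; apply/submodule_predP/UZ/submodule_predP.
by rewrite Quotient.idealrBE reprK.
Qed.

Fact quotient_scaleA a b v :
  quotient_scale a (quotient_scale b v) = quotient_scale (a * b) v.
Proof. by rewrite -[v]reprK (quotient_scale_pi b) !quotient_scale_pi scalerA. Qed.

Fact quotient_scale1 : left_id 1 quotient_scale.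
Proof. by move=> v; rewrite -[v]reprK quotient_scale_pi scale1r. Qed.

Fact quotient_scaleDr : right_distributive quotient_scale +%R.
Proof.
by move=> a x y; rewrite -[x]reprK -[y]reprK -raddfD !quotient_scale_pi scalerDr raddfD.
Qed.

Fact quotient_scaleDl v : {morph quotient_scale^~ v : a b / a + b}.
Proof.
by move=> a b; rewrite -[v]reprK !quotient_scale_pi scalerDl raddfD.
Qed.

HB.instance Definition _ := GRing.Zmodule_isLmodule.Build B Q
  quotient_scaleA quotient_scale1 quotient_scaleDr quotient_scaleDl.

Lemma quotient_object : exists (N : lmodType B) (p : {linear M -> N}),
  (forall z, exists y, p y = z) /\ forall x, p x = 0 <-> U x.
Proof.
have pi_linear : linear (\pi_Q : M -> Q).
  move=> a x y; rewrite raddfD; congr (_ + _).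
  exact/esym/quotient_scale_pi.
have [p pE] := linear_packing pi_linear.
exists (Q : lmodType B), p; split=> [z|x].
  by exists (repr z); rewrite pE reprK.
rewrite pE -(raddf0 (\pi_Q)); split=> [/eqP|Ux].
  by rewrite -Quotient.idealrBE subr0 => /submodule_predP.
by apply/eqP; rewrite -Quotient.idealrBE subr0; apply/submodule_predP.
Qed.

End SubmoduleObject.

(** * Finitely generated modules over artin algebras *)

Lemma finitely_generatedP (B : pzRingType) (M : lmodType B) :
  finitely_generated M <-> exists s : seq M, forall x, spanned s x.
Proof.
split=> [[n [g gP]]|[s sP]].
  exists [seq g i | i <- enum 'I_n] => x; have [c ->] := gP x.
  have [s0 sD sZ] := spanned_submodule [seq g i | i <- enum 'I_n].
  apply: (big_ind (spanned _)) => // i _; apply/sZ/mem_spanned.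
  by rewrite map_f ?mem_enum.
exists (size s), (fun i => s`_i) => x.
elim: s x {sP}(sP x) => [|v s IHs] x /= => [->|[a /IHs[c cE]]].
  by exists (fun=> 0); rewrite big_ord0.
exists (fun i => oapp c a (unlift ord0 i)).
rewrite big_ord_recl unlift_none /= -(subrK (a *: v) x) cE addrC.
by congr (_ + _); apply: eq_bigr => i _; rewrite liftK.
Qed.

Lemma finitely_generated_surjection (B : pzRingType) (M N : lmodType B)
    (p : {linear M -> N}) :
  (forall z, exists y, p y = z) -> finitely_generated M -> finitely_generated N.
Proof.
move=> p_surj [n [g gP]]; exists n, (fun i => p (g i)) => z.
have [y <-] := p_surj z; have [c ->] := gP y; exists c.
by rewrite linear_sum; apply: eq_bigr => i _; rewrite linearZ.
Qed.

Lemma regular_finitely_generated (B : pzRingType) : finitely_generated B^o.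
Proof.
apply/finitely_generatedP; exists [:: 1] => x; exists x.
by rewrite /= -[x *: _]/(x * 1) mulr1 subrr.
Qed.

Lemma finitely_generated_injection (B : pzRingType) (M N : lmodType B)
    (i : {linear N -> M}) :
  noetherian B^o -> injective i -> finitely_generated M -> finitely_generated N.
Proof.
move=> Bn i_inj /finitely_generatedP[s sP].
have [||t tP] := spanned_noetherian (s := s) Bn (W := fun x => exists y, i y = x).
- split=> [|_ _ [y <-] [z <-]|a _ [y <-]].
  + by exists 0; rewrite linear0.
  + by exists (y + z); rewrite linearD.
  by exists (a *: y); rewrite linearZ.
- by move=> x _; apply: sP.
apply/finitely_generatedP; suff [u uP]: fingen (fun _ : N => True).
  by exists u => y; apply/uP.
apply: (fingen_linear_relation (rho := fun y x => i y = x)) => //.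
- exact: linear0.
- by move=> y z _ _ <- <-; rewrite linearD.
- by move=> a y _ <-; rewrite linearZ.
- by move=> y _; exists (i y).
- exists t => x; split=> [[y [_ yx]]|/tP[y yx]]; last by exists y.
  by apply/tP; exists y.
by exists [::] => y; split=> [[_]|/= ->]; [rewrite -(linear0 i) => /i_inj|rewrite linear0].
Qed.

(** The morphism is a parameter of the type so that the scaling by R, which
    depends on it, can be inferred. *)
Definition restriction (A : pzRingType) (R : comPzRingType)
  (_ : {rmorphism R -> A}) (M : lmodType A^c) : Type := M.

Section RestrictionOfScalars.
Variables (A : pzRingType) (R : comPzRingType) (phi : {rmorphism R -> A}).
Variable M : lmodType A^c.
Local Notation N := (restriction phi M).

HB.instance Definition _ := GRing.Zmodule.on N.

Definition restriction_scale (r : R) (x : N) : N :=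
  (phi r : A^c) *: (x : M).

Fact restriction_scaleA r s x :
  restriction_scale r (restriction_scale s x) = restriction_scale (r * s) x.
Proof. by rewrite /restriction_scale scalerA mulrC rmorphM. Qed.

Fact restriction_scale1 : left_id 1 restriction_scale.
Proof. by move=> x; rewrite /restriction_scale rmorph1; apply: scale1r. Qed.

Fact restriction_scaleDr : right_distributive restriction_scale +%R.
Proof. by move=> r x y; apply: scalerDr. Qed.

Fact restriction_scaleDl x : {morph restriction_scale^~ x : r s / r + s}.
Proof. by move=> r s; rewrite /restriction_scale rmorphD; apply: scalerDl. Qed.

HB.instance Definition _ := GRing.Zmodule_isLmodule.Build R N
  restriction_scaleA restriction_scale1 restriction_scaleDr restriction_scaleDl.

End RestrictionOfScalars.

(** A left ideal of B is finitely generated over R, whose image is central.  This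
    is put as an induction principle, in which R no longer appears. *)
Lemma artin_algebra_left_ideal (A : pzRingType) : artin_algebra A ->
  forall I : (A^c)^o -> Prop, submodule I ->
  exists s : seq A^c, (forall x, x \in s -> I x) /\
    forall P : A^c -> Prop, P 0 -> (forall x y, P x -> P y -> P (x + y)) ->
    (forall c x, (forall b, c * b = b * c) -> P x -> P (c * x)) ->
    (forall x, x \in s -> P x) -> forall x, I x -> P x.
Proof.
move=> [R [phi [Rart phi_central [n [g gP]]]]] I [I0 ID IZ].
pose V : lmodType R := restriction phi (A^c)^o.
pose G : seq V := [seq (g i : A^c) | i <- enum 'I_n].
have GV x : spanned G x.
  have [c ->] := gP x; have [s0 sD sZ] := spanned_submodule G.
  apply: (big_ind (spanned G)) => // i _.
  have <- : c i *: (g i : V) = phi (c i) * g i by rewrite phi_central.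
  by apply/sZ/mem_spanned; rewrite map_f ?mem_enum.
have [||s sP] := spanned_noetherian (s := G) (artinian_noetherian Rart) (W := I).
- by split=> // r x Ix; apply: (IZ (phi r)).
- by [].
exists s; split=> [x sx|P P0 PD PZ Ps x /sP].
  by apply/sP; apply: (mem_spanned (V := V)).
apply: (spanned_min (U := P : V -> Prop)) => //; split=> // r y Py.
by apply: (PZ (phi r)) => // b; apply/esym/phi_central.
Qed.

Lemma artin_algebra_noetherian (A : pzRingType) :
  artin_algebra A -> noetherian (A^c)^o.
Proof.
move=> hA I Is _; have [s [sI sP]] := artin_algebra_left_ideal hA Is.
have [s0 sD sZ] := spanned_submodule (s : seq (A^c)^o).
apply: (fingen_mem (s := s : seq (A^c)^o)) => // x; apply: sP => //.
  by move=> c y _; apply: sZ.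
by move=> y ys; apply: (mem_spanned (V := (A^c)^o)).
Qed.

(** * Omega-torsion pairs and left semicentral idempotents *)

Lemma isomorphic_of_bijection (B : pzRingType) (M N : lmodType B)
    (f : {linear M -> N}) :
  injective f -> (forall z, exists y, f y = z) ->
  isomorphic M N /\ isomorphic N M.
Proof.
move=> f_inj f_surj.
have [g gP] := injection_lift (f := (idfun : {linear N -> N})) f_inj f_surj.
have gK : cancel f g by move=> x; apply: f_inj; rewrite gP.
by split; [exists f; exists g|exists g; exists f].
Qed.

Lemma Ext1_zero_retraction (B : pzRingType) (L M N : lmodType B)
    (i : {linear L -> M}) (p : {linear M -> N}) :
  Ext1_zero N L -> short_exact i p ->
  exists r : {linear M -> L}, forall x, r (i x) = x.
Proof.
move=> ext0 ip; have [h [hi _]] := ext0 (Extension ip).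
have r_linear : linear (fun y => (h y).1) by move=> a x y; rewrite linearP.
have [r rE] := linear_packing r_linear; exists r => x.
by rewrite rE; have /= -> := hi x.
Qed.

Lemma Ext1_zero_section (B : pzRingType) (L M N : lmodType B)
    (i : {linear L -> M}) (p : {linear M -> N}) :
  Ext1_zero N L -> short_exact i p ->
  exists s : {linear N -> M}, forall z, p (s z) = z.
Proof.
move=> ext0 ip; have [r ri] := Ext1_zero_retraction ext0 ip.
case: ip => _ p_surj p_ker.
have f_linear : linear (fun y => y - i (r y)).
  by move=> a x y; rewrite !linearP /= addrACA scalerBr scalerN.
have [f fE] := linear_packing f_linear.
have [y /p_ker[x <-]|s sP] := surjection_factor (f := f) p_surj.
  by rewrite fE ri subrr.
exists s => z; have [y <-] := p_surj z; rewrite sP fE linearB.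
by have /p_ker -> : exists x, i x = i (r y) by [exists (r y)]; rewrite subr0.
Qed.

(** The case b = 1 gives e * e = e. *)
Definition left_semicentral (B : pzRingType) (e : B) : Prop :=
  forall b, b * e = e * (b * e).

Lemma left_semicentral_idempotent (B : pzRingType) (e : B) :
  left_semicentral e -> e * e = e.
Proof. by move=> /(_ 1); rewrite !mul1r => <-. Qed.

(** If e fixes s and a fixes v - e v, then 1 - (1 - a)(1 - e) fixes v and s. *)
Lemma common_left_unit (B : pzRingType) (I : B^o -> Prop) (s : seq B) :
  submodule I -> (forall x, I x -> exists a, I a /\ a * x = x) ->
  (forall x, x \in s -> I x) -> exists e, I e /\ forall x, x \in s -> e * x = x.
Proof.
move=> [I0 ID IZ] unit_of; elim: s => [|v s IHs] sI; first by exists 0.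
have [x xs|e [Ie eP]] := IHs; first by apply: sI; rewrite inE xs orbT.
have Iv : I v by apply/sI/mem_head.
have [|a [Ia aP]] := unit_of (v - e * v).
  by apply: ID => //; rewrite -mulNr; apply: (IZ (- _)).
exists (e + a - a * e); split=> [|x].
  by rewrite -addrA -mulN1r mulrA; apply/ID/ID => //; apply: (IZ (_ * _)).
rewrite inE mulrBl mulrDl -mulrA => /predU1P[->|/eP ->]; last by rewrite addrK.
by rewrite -addrA -mulrBr aP addrC subrK.
Qed.

Section OmegaTorsionPair.
Variable A : pzRingType.
Local Notation B := (A^c : pzRingType).
Hypothesis B_noetherian : noetherian B^o.

Section ClosureProperties.
Variable o : omega_torsion_pair A.
Local Notation T := (torsion_class o).
Local Notation F := (torsionfree_class o).

Lemma torsion_class_quotient (X Q : modcat A) (p : {linear X -> Q}) :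
  (forall z, exists y, p y = z) -> T X -> T Q.
Proof.
have [Tiso _ hom0 /(_ Q)[tQ [fQ [i [q [[i_inj q_surj q_ker] TtQ FfQ]]]]]] :=
  otp_torsion_pair o.
move=> p_surj TX; apply: (Tiso tQ) => //.
apply: (isomorphic_of_bijection i_inj _).1 => z.
apply/q_ker; have [y <-] := p_surj z.
exact: (hom0 _ _ TX FfQ (q \o p : {linear X -> fQ})).
Qed.

Lemma torsionfree_of_torsion_zero (Q : modcat A) :
  (forall (tQ : modcat A) (i : {linear tQ -> Q}), T tQ -> injective i ->
     forall x, i x = 0) -> F Q.
Proof.
have [_ Fiso _ /(_ Q)[tQ [fQ [i [q [[i_inj q_surj q_ker] TtQ FfQ]]]]]] :=
  otp_torsion_pair o.
move=> tQ0; apply: (Fiso fQ) => //.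
apply: (isomorphic_of_bijection (f := q) _ q_surj).2 => x y xy.
have /q_ker[z zE] : q (x - y) = 0 by rewrite linearB xy subrr.
by apply/eqP; rewrite -subr_eq0 -zE (tQ0 _ i).
Qed.

Lemma torsionfree_class_sub (X N : modcat A) (j : {linear N -> X}) :
  injective j -> F X -> F N.
Proof.
have [_ _ hom0 _] := otp_torsion_pair o.
move=> j_inj FX; apply: torsionfree_of_torsion_zero => tN i TtN _ x.
by apply: j_inj; rewrite linear0; apply: (hom0 _ _ TtN FX (j \o i : {linear tN -> X})).
Qed.

(** Let i : tQ -> Q be a torsion submodule and Y its preimage in X.  The kernel
    of Y -> tQ is in F, so Y -> tQ has a section; it is a map from a torsion
    module to X, hence zero, and then tQ is zero. *)
Lemma torsionfree_class_quotient (X Q : modcat A) (p : {linear X -> Q}) :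
  (forall z, exists y, p y = z) -> F X -> F Q.
Proof.
have [_ _ hom0 _] := otp_torsion_pair o.
move=> p_surj FX; apply: torsionfree_of_torsion_zero => tQ i TtQ i_inj x.
have Y_sub : submodule (fun y => exists t, i t = p y).
  split=> [|y z [t tE] [u uE]|a y [t tE]].
  - by exists 0; rewrite !linear0.
  - by exists (t + u); rewrite !linearD tE uE.
  by exists (a *: t); rewrite !linearZ tE.
have [Y [j [j_inj jP]]] := submodule_object Y_sub.
have jY y : exists t, i t = (p \o j) y by apply/jP; exists y.
have [r rP] := injection_lift i_inj jY.
have r_surj t : exists y, r y = t.
  have [z zt] := p_surj (i t).
  have /jP[y yz] : exists t, i t = p z by exists t.
  by exists y; apply: i_inj; rewrite rP /= yz.
have K_sub : submodule (fun y => r y = 0).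
  split=> [|y z y0 z0|a y y0]; first exact: linear0.
    by rewrite linearD y0 z0 addr0.
  by rewrite linearZ /= y0 scaler0.
have [K [k [k_inj kP]]] := submodule_object K_sub.
have Yfg := finitely_generated_injection B_noetherian j_inj (fgmod_fg X).
have Kfg := finitely_generated_injection B_noetherian k_inj Yfg.
have FK : F (FgMod Kfg).
  have jk_inj : injective (j \o k : {linear FgMod Kfg -> X}) by apply: inj_comp.
  exact: torsionfree_class_sub jk_inj FX.
have ex : short_exact k r by [].
have [s sP] := Ext1_zero_section (otp_Ext1_zero TtQ FK) ex.
have := hom0 _ _ TtQ FX (j \o s : {linear tQ -> X}) x.
by rewrite /= -[x in i x]sP rP /= => ->; rewrite linear0.
Qed.

(** Here tB plays the role of the ideal I = i(tB).  In P = X/Ix the image Z of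
    Bx is a quotient of B/I, so it is in F, while P and P/Z are in T.  The
    sequence Z -> P -> P/Z splits and its retraction P -> Z is zero: thus Z = 0
    and x is in Ix. *)
Lemma mem_torsion_ideal_scale (tB fB : modcat A) (i : {linear tB -> B^o})
    (p : {linear B^o -> fB}) :
  short_exact i p -> F fB -> forall X : modcat A, T X ->
  forall x : X, exists t, x = i t *: x.
Proof.
move=> [i_inj p_surj p_ker] FfB X TX x.
have Ix_sub : submodule (fun y : X => exists t, y = i t *: x).
  split=> [|y z [t tE] [u uE]|a y [t tE]].
  - by exists 0; rewrite linear0 scale0r.
  - by exists (t + u); rewrite linearD scalerDl tE uE.
  by exists (a *: t); rewrite linearZ tE scalerA.
have [P [pi [pi_surj piP]]] := quotient_object Ix_sub.
have Z_sub : submodule (fun y : P => exists b, y = b *: pi x).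
  split=> [|y z [b bE] [c cE]|a y [b bE]].
  - by exists 0; rewrite scale0r.
  - by exists (b + c); rewrite scalerDl bE cE.
  by exists (a * b); rewrite bE scalerA.
have [Z [j [j_inj jP]]] := submodule_object Z_sub.
have [Q [q [q_surj qP]]] := quotient_object Z_sub.
have Pfg := finitely_generated_surjection pi_surj (fgmod_fg X).
have Qfg := finitely_generated_surjection q_surj Pfg.
have Zfg := finitely_generated_injection B_noetherian j_inj Pfg.
have TP : T (FgMod Pfg).
  exact: (torsion_class_quotient (Q := FgMod Pfg) (p := pi)) TX.
have TQ : T (FgMod Qfg).
  exact: (torsion_class_quotient (X := FgMod Pfg) (Q := FgMod Qfg) (p := q)) TP.
have FZ : F (FgMod Zfg).
  have c_linear : linear (fun b : B^o => b *: pi x).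
    by move=> a b c; rewrite scalerDl scalerA.
  have [c cE] := linear_packing c_linear.
  have [|m mP] := injection_lift (f := c) j_inj.
    by move=> b; apply/jP; exists b; rewrite cE.
  have [|h hP] := surjection_factor (f := m) p_surj.
    move=> b /p_ker[t <-]; apply: j_inj; rewrite mP cE linear0 -linearZ.
    by apply/piP; exists t.
  apply: (torsionfree_class_quotient (Q := FgMod Zfg) (p := h)) FfB => z.
  have /jP[b bE] : exists y, j y = j z by exists z.
  by exists (p b); rewrite hP; apply: j_inj; rewrite mP cE.
have ex : short_exact j q.
  by split=> // y; rewrite -jP; apply: qP.
have [r rP] := Ext1_zero_retraction (otp_Ext1_zero TQ FZ) ex.
have [_ _ hom0 _] := otp_torsion_pair o.
have /jP[z zE] : exists b, pi x = b *: pi x by exists 1; rewrite scale1r.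
by apply/piP; rewrite -zE -[z]rP (hom0 _ _ TP FZ r) linear0.
Qed.

Hypothesis hA : artin_algebra A.

(** The idempotent is a left identity in the torsion part I of B.  It is left
    semicentral because I is a left ideal. *)
Lemma otp_semicentral_idempotent : exists e : B, left_semicentral e /\
  forall X : modcat A, (T X <-> forall x : X, e *: x = x) /\
    (F X <-> forall x : X, e *: x = 0).
Proof.
have [_ _ hom0 dec] := otp_torsion_pair o.
have [tB [fB [i [p [ex TtB FfB]]]]] := dec (FgMod (regular_finitely_generated B)).
pose I (b : B^o) := exists t, i t = b.
have I_sub : submodule I.
  split=> [|_ _ [t <-] [u <-]|a _ [t <-]].
  - by exists 0; rewrite linear0.
  - by exists (t + u); rewrite linearD.
  by exists (a *: t); rewrite linearZ.
have unit_of x : I x -> exists a, I a /\ a * x = x.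
  case=> t <-; have [u tE] := mem_torsion_ideal_scale ex FfB TtB t.
  by exists (i u); split; [exists u|rewrite -[_ * _]linearZ -tE].
have [s [sI sP]] := artin_algebra_left_ideal hA I_sub.
have [e [Ie eP]] := common_left_unit I_sub unit_of sI.
have eI : forall x, I x -> e * x = x.
  apply: sP => //; first exact: mulr0.
    by move=> x y ex_ ey; rewrite mulrDr ex_ ey.
  by move=> c x cc ex_; rewrite mulrA -cc -mulrA ex_.
have T_fixed (X : modcat A) : T X -> forall x : X, e *: x = x.
  move=> TX x; have [t tx] := mem_torsion_ideal_scale ex FfB TX x.
  by rewrite [in LHS]tx scalerA eI; [apply: esym|exists t].
have F_killed (X : modcat A) : F X -> forall x : X, e *: x = 0.
  move=> FX x; have [t <-] := Ie.
  have c_linear : linear (fun b : B^o => b *: x).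
    by move=> a b c; rewrite scalerDl scalerA.
  have [c cE] := linear_packing c_linear.
  by rewrite -cE; apply: (hom0 _ _ TtB FX (c \o i : {linear tB -> X})).
exists e; split=> [b|X].
  by rewrite eI //; case: I_sub => _ _ IZ; apply: (IZ b).
have [tX [fX [iX [pX [[iX_inj pX_surj pX_ker] TtX FfX]]]]] := dec X.
have [Tiso Fiso _ _] := otp_torsion_pair o.
split; split; [exact: T_fixed| |exact: F_killed|] => e_act.
  apply: (Tiso tX) => //; apply: (isomorphic_of_bijection iX_inj _).1 => z.
  by apply/pX_ker; rewrite -[z]e_act linearZ /= F_killed.
apply: torsionfree_of_torsion_zero => Y j TY _ y.
by rewrite -[y]T_fixed // linearZ /= e_act.
Qed.

End ClosureProperties.

Lemma otp_eq (o o' : omega_torsion_pair A) :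
  (forall X, torsion_class o X <-> torsion_class o' X) ->
  (forall X, torsionfree_class o X <-> torsionfree_class o' X) -> o = o'.
Proof.
case: o o' => [T F tp ext0] [T' F' tp' ext0'] /= TT' FF'.
have eT : T = T' by apply: funext => X; apply: propext.
have eF : F = F' by apply: funext => X; apply: propext.
case: _ / eT tp' ext0' {TT'} => tp' ext0'; case: _ / eF tp' ext0' {FF'} => tp' ext0'.
by rewrite (Prop_irrelevance tp tp') (Prop_irrelevance ext0 ext0').
Qed.

Section IdempotentPair.
Variables (e : B) (e_sc : left_semicentral e).

(** This is eM; semicentrality is what makes it stable under B. *)
Lemma semicentral_fixed_submodule (M : lmodType B) :
  submodule (fun x : M => e *: x = x).
Proof.
split=> [|x y xE yE|b x xE]; first exact: scaler0.
  by rewrite scalerDr xE yE.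
by rewrite -[in LHS]xE !scalerA -mulrA -e_sc -scalerA xE.
Qed.

Fact idempotent_torsion_pair :
  torsion_pair (fun X : modcat A => forall x : X, e *: x = x)
               (fun X : modcat A => forall x : X, e *: x = 0).
Proof.
split.
- move=> M N [f [g gK fK]] MT x.
  by rewrite -[x]fK -linearZ MT.
- move=> M N [f [g gK fK]] MF x.
  by rewrite -[x]fK -linearZ /= MF linear0.
- by move=> X Y XT YF f x; rewrite -[x]XT linearZ /= YF.
move=> X.
have [tX [i [i_inj iP]]] := submodule_object (semicentral_fixed_submodule X).
have [fX [p [p_surj pP]]] := quotient_object (semicentral_fixed_submodule X).
have tXfg := finitely_generated_injection B_noetherian i_inj (fgmod_fg X).
have fXfg := finitely_generated_surjection p_surj (fgmod_fg X).
exists (FgMod tXfg), (FgMod fXfg), i, p; split=> [|x|z].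
- by split=> // y; rewrite -iP; apply: pP.
- by apply: i_inj; rewrite linearZ /=; apply/iP; exists x.
have [y <-] := p_surj z; rewrite -linearZ; apply/pP.
by rewrite scalerA left_semicentral_idempotent.
Qed.

(** The map y |-> y - e y sends E into Y and is the identity on Y.  It is linear:
    b (y - e y) lies in the image of Y, so e b (y - e y) = 0, that is
    e b y = b e y. *)
Fact idempotent_Ext1_zero (X Y : modcat A) :
  (forall x : X, e *: x = x) -> (forall y : Y, e *: y = 0) -> Ext1_zero X Y.
Proof.
move=> XT YF [E i p [i_inj p_surj p_ker]].
have d_ker y : exists x, i x = y - e *: y.
  by apply/p_ker; rewrite linearB linearZ /= XT subrr.
have d_linear : linear (fun y : E => y - e *: y).
  move=> b y z; rewrite scalerDr opprD addrACA; congr (_ + _).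
  rewrite scalerBr; congr (_ - _); have [x xE] := d_ker y.
  have : e *: (b *: (y - e *: y)) = 0.
    by rewrite -xE -[b *: _]linearZ -[e *: _]linearZ /= YF linear0.
  rewrite !scalerBr => /eqP; rewrite subr_eq0 => /eqP->.
  by rewrite [b *: (e *: y)]scalerA scalerA -e_sc.
have [d dE] := linear_packing d_linear.
have [r rP] : exists r : {linear E -> Y}, forall y, i (r y) = d y.
  apply: injection_lift i_inj _ => y; have [x xE] := d_ker y.
  by exists x; rewrite xE dE.
have h_linear : linear (fun y => (r y, p y) : (Y * X)%type).
  by move=> a y z; congr pair; apply: linearP.
have [h hE] := linear_packing h_linear.
exists h; split=> [x|y] /=; rewrite hE //.
congr pair; last by apply/p_ker; exists x.
by apply: i_inj; rewrite rP dE -linearZ /= YF linear0 subr0.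
Qed.

Definition idempotent_otp : omega_torsion_pair A :=
  OmegaTorsionPair idempotent_torsion_pair idempotent_Ext1_zero.

End IdempotentPair.

End OmegaTorsionPair.

(** * Finite distributive lattices from preorders *)

(** A preorder with distributive meets and joins; its quotient by the associated
    equivalence is a distributive lattice. *)
Section PreorderQuotient.
Variables (D : choiceType) (le : rel D) (meet join : D -> D -> D) (bot top : D).
Hypotheses (leD_refl : reflexive le) (leD_trans : transitive le).
Hypothesis le_meet : forall x y z, le x (meet y z) = le x y && le x z.
Hypothesis join_le : forall x y z, le (join x y) z = le x z && le y z.
Hypothesis meet_join : forall x y z,
  le (meet (join x y) z) (join (meet x z) (meet y z)).
Hypotheses (bot_le : forall x, le bot x) (le_top : forall x, le x top).

Definition preorder_equiv : rel D := fun x y => le x y && le y x.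

Fact preorder_equiv_class : equiv_class_of preorder_equiv.
Proof.
split=> [x|x y|y x z]; rewrite /preorder_equiv ?leD_refl //.
  by rewrite andbC.
by move=> /andP[xy yx] /andP[yz zy]; rewrite (leD_trans xy yz) (leD_trans zy yx).
Qed.
Canonical preorder_equiv_equiv := EquivRelPack preorder_equiv_class.
Canonical preorder_equiv_encModRel := defaultEncModRel preorder_equiv.

Definition preorder_quotient := {eq_quot preorder_equiv}.
Local Notation Q := preorder_quotient.
HB.instance Definition _ := Choice.on Q.
HB.instance Definition _ : EqQuotient D preorder_equiv Q := EqQuotient.on Q.

Fact preorder_quotient_display : Order.disp_t.
Proof. exact: Order.Disp tt tt. Qed.

Definition quotient_le : rel Q := fun x y => le (repr x) (repr y).

Lemma repr_pi_equiv x : le (repr (\pi_Q x)%qT) x /\ le x (repr (\pi_Q x)%qT).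
Proof. by apply/andP; have /eqmodP := reprK (\pi_Q x)%qT. Qed.

Fact quotient_le_refl : reflexive quotient_le.
Proof. by move=> x; apply: leD_refl. Qed.

Fact quotient_le_anti : antisymmetric quotient_le.
Proof. by move=> x y xy; rewrite -[x]reprK -[y]reprK; apply/eqmodP. Qed.

Fact quotient_le_trans : transitive quotient_le.
Proof. by move=> y x z; apply: leD_trans. Qed.

HB.instance Definition _ := Order.Le_isPOrder.Build preorder_quotient_display Q
  quotient_le_refl quotient_le_anti quotient_le_trans.

Definition quotient_meet (x y : Q) : Q := (\pi_Q (meet (repr x) (repr y)))%qT.
Definition quotient_join (x y : Q) : Q := (\pi_Q (join (repr x) (repr y)))%qT.

Fact quotient_meetP x y z :
  (x <= quotient_meet y z)%O = (x <= y)%O && (x <= z)%O.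
Proof.
have [l g] := repr_pi_equiv (meet (repr y) (repr z)).
rewrite -[RHS]/(le (repr x) (repr y) && le (repr x) (repr z)) -le_meet.
by apply/idP/idP => h; apply: leD_trans h _.
Qed.

Fact quotient_joinP x y z :
  (quotient_join x y <= z)%O = (x <= z)%O && (y <= z)%O.
Proof.
have [l g] := repr_pi_equiv (join (repr x) (repr y)).
rewrite -[RHS]/(le (repr x) (repr z) && le (repr y) (repr z)) -join_le.
by apply/idP/idP => h; apply: leD_trans _ h.
Qed.

HB.instance Definition _ := Order.POrder_MeetJoin_isLattice.Build
  preorder_quotient_display Q quotient_meetP quotient_joinP.

Lemma le_join x y : (le x (join x y) * le y (join x y))%type.
Proof. by apply/andP; rewrite -join_le leD_refl. Qed.

Lemma meet_le x y : (le (meet x y) x * le (meet x y) y)%type.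
Proof. by apply/andP; rewrite -le_meet leD_refl. Qed.

Lemma le_join2 x y x' y' : le x x' -> le y y' -> le (join x y) (join x' y').
Proof.
have [? ?] := le_join x' y'.
by move=> xx yy; rewrite join_le (leD_trans xx) // (leD_trans yy).
Qed.

Lemma le_meet2 x y x' y' : le x x' -> le y y' -> le (meet x y) (meet x' y').
Proof.
have [h1 h2] := meet_le x y.
by move=> xx yy; rewrite le_meet (leD_trans h1) // (leD_trans h2).
Qed.

Fact quotient_meetUl :
  @left_distributive Q Q Order.meet Order.join.
Proof.
move=> x y z; apply: le_anti; apply/andP; split; last first.
  by rewrite leUx !lexI !leIr !(le_trans (leIl _ _)) ?leUl ?leUr.
change (quotient_le (quotient_meet (quotient_join x y) z)
  (quotient_join (quotient_meet x z) (quotient_meet y z))).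
apply: (leD_trans (repr_pi_equiv _).1); apply: leD_trans (repr_pi_equiv _).2.
apply: leD_trans (leD_trans (meet_join (repr x) (repr y) (repr z)) _).
  by apply: le_meet2; rewrite ?leD_refl //; apply: (repr_pi_equiv _).1.
by apply: le_join2; apply: (repr_pi_equiv _).2.
Qed.

HB.instance Definition _ := Order.Lattice_Meet_isDistrLattice.Build
  preorder_quotient_display Q quotient_meetUl.

Fact quotient_bot_le x : (\pi_Q bot <= x)%O.
Proof. exact: leD_trans (repr_pi_equiv _).1 (bot_le _). Qed.

Fact quotient_le_top x : (x <= \pi_Q top)%O.
Proof. exact: leD_trans (le_top _) (repr_pi_equiv _).2. Qed.

HB.instance Definition _ :=
  Order.hasBottom.Build preorder_quotient_display Q quotient_bot_le.
HB.instance Definition _ :=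
  Order.hasTop.Build preorder_quotient_display Q quotient_le_top.

Definition down_finite x :=
  exists s : seq D, forall y, le y x -> has (preorder_equiv y) s.

Hypothesis min_exists : forall P : D -> Prop, (exists x, P x) ->
  exists x, P x /\ forall y, P y -> le y x -> le x y.
Hypothesis max_exists : forall P : D -> Prop, (exists x, P x) ->
  exists x, P x /\ forall y, P y -> le x y -> le y x.

(** Take x minimal such that infinitely many classes lie below x.  If
    x <= y v z with y and z strictly below x, then every w <= x equals
    (y ^ w) v (z ^ w), and there are finitely many such joins.  Otherwise an
    element m maximal among those strictly below x is the greatest of them, for
    w v m cannot reach x; so what lies below x is x and what lies below m. *)
Lemma all_down_finite x : down_finite x.
Proof.
apply: contrapT => /(ex_intro (fun x => ~ down_finite x) _) /min_exists.
move=> {x} [x [xN xmin]].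
have fin_lt y : le y x -> ~~ le x y -> down_finite y.
  by move=> yx; apply: contraNP => /xmin /(_ yx).
have lt_equiv y : le y x -> preorder_equiv y x || ~~ le x y.
  by move=> yx; rewrite /preorder_equiv yx /= orbN.
apply: xN.
have [[y [z [yx zx xyz ltyx ltzx]]]|irr] :=
    EM (exists y z, [/\ le y x, le z x, le x (join y z), ~~ le x y & ~~ le x z]).
  have [s sP] := fin_lt y yx ltyx; have [t tP] := fin_lt z zx ltzx.
  exists [seq join a b | a <- s, b <- t] => w wx.
  have /hasP[a sa /andP[wa aw]] := sP _ (meet_le w y).2.
  have /hasP[b tb /andP[wb bw]] := tP _ (meet_le w z).2.
  apply/hasP; exists (join a b); first exact: allpairs_f.
  have [my mz] : le (meet w y) w /\ le (meet w z) w by rewrite !(meet_le w _).1.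
  apply/andP; split; last by rewrite join_le (leD_trans aw) // (leD_trans bw).
  apply: (@leD_trans (meet (join y z) w)).
    by rewrite le_meet leD_refl (leD_trans wx).
  apply: leD_trans (meet_join _ _ _) _; apply: le_join2.
    by apply: leD_trans wa; rewrite le_meet !(meet_le y w).
  by apply: leD_trans wb; rewrite le_meet !(meet_le z w).
have [ex_lt|no_lt] := EM (exists y, le y x /\ ~~ le x y); last first.
  exists [:: x] => w wx; rewrite /= orbF.
  by have /orP[//|ltwx] := lt_equiv w wx; case: no_lt; exists w.
have [m [[mx ltmx] mmax]] := max_exists ex_lt.
have [s sP] := fin_lt m mx ltmx.
exists (x :: s) => w wx /=.
have /orP[->//|ltwx] := lt_equiv w wx.
apply/orP; right; apply: sP.
have jx : le (join w m) x by rewrite join_le wx.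
have ltj : ~~ le x (join w m) by apply/negP => xj; apply: irr; exists w, m.
by apply: leD_trans (le_join w m).1 (mmax _ _ (le_join w m).2).
Qed.

Let top_finite : exists s : seq D, forall y, has (preorder_equiv y) s.
Proof. by have [s sP] := all_down_finite top; exists s => y; apply: sP. Qed.

Definition quotient_enum : seq Q :=
  undup [seq \pi_Q x | x <- projT1 (cid top_finite)].

Lemma mem_quotient_enum (x : Q) : x \in quotient_enum.
Proof.
rewrite mem_undup; have /hasP[y sy xy] := projT2 (cid top_finite) (repr x).
by apply/mapP; exists y => //; rewrite -[LHS]reprK; apply/eqmodP.
Qed.

Lemma quotient_indexK :
  cancel (fun x : Q => index x quotient_enum) (nth (\pi_Q bot) quotient_enum).
Proof. by move=> x; rewrite nth_index ?mem_quotient_enum. Qed.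

HB.instance Definition _ := CanIsCountable quotient_indexK.

Fact quotient_enumP : Finite.axiom quotient_enum.
Proof. exact: Finite.uniq_enumP (undup_uniq _) mem_quotient_enum. Qed.

HB.instance Definition _ := isFinite.Build Q quotient_enumP.

Lemma finite_distributive_quotient :
  exists (d : Order.disp_t) (L : finTBDistrLatticeType d) (r : L -> D),
    (forall x y : L, (x <= y)%O = le (r x) (r y)) /\
    (forall x : D, exists y : L, le x (r y) && le (r y) x).
Proof.
exists preorder_quotient_display, (Q : finTBDistrLatticeType _), repr.
split=> // x; exists (\pi_Q x).
by have [-> ->] := repr_pi_equiv x.
Qed.

End PreorderQuotient.

(** * The lattice of left semicentral idempotents *)

Section SemicentralIdempotents.
Variable B : pzRingType.
Implicit Types e f g : B.

Lemma left_semicentral0 : left_semicentral (0 : B).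
Proof. by move=> b; rewrite mul0r mulr0. Qed.

Lemma left_semicentral1 : left_semicentral (1 : B).
Proof. by move=> b; rewrite mul1r. Qed.

Lemma left_semicentralM e f :
  left_semicentral e -> left_semicentral f -> left_semicentral (e * f).
Proof.
by move=> eC fC b; rewrite -mulrA [b * (e * f)]mulrA -fC [e * (_ * f)]mulrA -eC.
Qed.

(** The element e + f - e f is a left identity on Be and on Bf, since
    f b e = e f b e. *)
Lemma join_fixes_left e f b :
  left_semicentral e -> (e + f - e * f) * (b * e) = b * e.
Proof.
move=> eC; rewrite mulrBl mulrDl -eC -mulrA [f * (b * e)]mulrA.
by rewrite -eC addrK.
Qed.

Lemma join_fixes_right e f b :
  left_semicentral f -> (e + f - e * f) * (b * f) = b * f.
Proof. by move=> fC; rewrite mulrBl mulrDl -mulrA -fC addrC addrA addNr add0r. Qed.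

Lemma left_semicentral_join e f :
  left_semicentral e -> left_semicentral f -> left_semicentral (e + f - e * f).
Proof.
move=> eC fC b; set j := e + f - e * f.
rewrite {1 3}/j mulrBr mulrDr [b * (e * f)]mulrA mulrBr mulrDr.
by rewrite join_fixes_left // !join_fixes_right.
Qed.

Definition semicentral : Type := {e : B | `[<left_semicentral e>]}.
HB.instance Definition _ := Choice.on semicentral.

Lemma semicentralP (x : semicentral) : left_semicentral (val x).
Proof. exact/asboolP/(valP x). Qed.

Definition mk_semicentral e (eC : left_semicentral e) : semicentral :=
  exist _ e (introT (asboolP _) eC).

(** Inclusion of eB in fB: a preorder that is not antisymmetric in general. *)
Definition semicentral_le : rel semicentral :=
  fun x y => val y * val x == val x.
Definition semicentral_meet (x y : semicentral) : semicentral :=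
  mk_semicentral (left_semicentralM (semicentralP x) (semicentralP y)).
Definition semicentral_join (x y : semicentral) : semicentral :=
  mk_semicentral (left_semicentral_join (semicentralP x) (semicentralP y)).

Lemma semicentral_idem (x : semicentral) : val x * val x = val x.
Proof. exact/left_semicentral_idempotent/semicentralP. Qed.

Lemma semicentral_le_refl : reflexive semicentral_le.
Proof. by move=> x; apply/eqP/semicentral_idem. Qed.

Lemma semicentral_le_trans : transitive semicentral_le.
Proof.
move=> y x z /eqP xy /eqP yz; apply/eqP.
by rewrite -xy mulrA yz.
Qed.

Lemma semicentral_le_meet x y z :
  semicentral_le x (semicentral_meet y z) = semicentral_le x y && semicentral_le x z.
Proof.
rewrite /semicentral_le /=; apply/eqP/andP => [yzx|[/eqP yx /eqP zx]].
  split; apply/eqP; rewrite -yzx; first by rewrite !mulrA semicentral_idem.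
  by rewrite mulrA -semicentralP.
by rewrite -mulrA zx yx.
Qed.

Lemma semicentral_join_le x y z :
  semicentral_le (semicentral_join x y) z = semicentral_le x z && semicentral_le y z.
Proof.
rewrite /semicentral_le /=; apply/eqP/andP => [zj|[/eqP zx /eqP zy]].
  split; apply/eqP.
    have := join_fixes_left (val y) 1 (semicentralP x); rewrite mul1r => <-.
    by rewrite mulrA zj.
  have := join_fixes_right (val x) 1 (semicentralP y); rewrite mul1r => <-.
  by rewrite mulrA zj.
by rewrite mulrBr mulrDr mulrA zx zy.
Qed.

Lemma semicentral_meet_join x y z :
  semicentral_le (semicentral_meet (semicentral_join x y) z)
    (semicentral_join (semicentral_meet x z) (semicentral_meet y z)).
Proof.
pose j := val (semicentral_join (semicentral_meet x z) (semicentral_meet y z)).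
have jx : j * (val x * val z) = val x * val z.
  have := join_fixes_left (val y * val z) 1 (semicentralP (semicentral_meet x z)).
  by rewrite mul1r.
have jy b : j * (b * (val y * val z)) = b * (val y * val z).
  exact/join_fixes_right/(semicentralP (semicentral_meet y z)).
apply/eqP; change (j * ((val x + val y - val x * val y) * val z) =
  (val x + val y - val x * val y) * val z).
have := jy 1; rewrite mul1r => jy1; clearbody j.
by rewrite mulrBl mulrDl -(mulrA (val x)) mulrBr mulrDr jx jy jy1.
Qed.

Lemma semicentral_bot_le x : semicentral_le (mk_semicentral left_semicentral0) x.
Proof. by rewrite /semicentral_le /= mulr0. Qed.

Lemma semicentral_le_top x : semicentral_le x (mk_semicentral left_semicentral1).
Proof. by rewrite /semicentral_le /= mul1r. Qed.

Hypothesis B_noetherian : noetherian B^o.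

(** Descending idempotents have ascending left annihilators. *)
Lemma semicentral_min (P : semicentral -> Prop) : (exists x, P x) ->
  exists x, P x /\ forall y, P y -> semicentral_le y x -> semicentral_le x y.
Proof.
apply: (@minimal_of_chains _ semicentral_le) => x xP.
have [n|n b be|n nP] := ascending_chain (U := fun n (b : B^o) => b * val (x n) = 0)
    B_noetherian.
- split=> [|b c be ce|a b be]; first exact: mul0r.
    by rewrite mulrDl be ce addr0.
  by rewrite -[a *: b]/(a * b) -mulrA be mulr0.
- by rewrite -(eqP (xP n)) mulrA be mul0r.
exists n; apply/eqP/esym/eqP; rewrite -subr_eq0 -[X in X - _]mul1r -mulrBl.
by apply/eqP/nP; rewrite mulrBl mul1r semicentral_idem subrr.
Qed.

(** The fixed elements of e form the left ideal eB, which grows with e. *)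
Lemma semicentral_max (P : semicentral -> Prop) : (exists x, P x) ->
  exists x, P x /\ forall y, P y -> semicentral_le x y -> semicentral_le y x.
Proof.
apply: (@minimal_of_chains _ (fun x y => semicentral_le y x)) => x xP.
have [n|n b be|n nP] := ascending_chain (U := fun n (b : B^o) => val (x n) * b = b)
    B_noetherian.
- split=> [|b c be ce|a b be]; first exact: mulr0.
    by rewrite mulrDr be ce.
  rewrite -[a *: b]/(a * b) -[in LHS]be [a * (_ * b)]mulrA mulrA.
  by rewrite -semicentralP -mulrA be.
- by rewrite -be mulrA (eqP (xP n)).
by exists n; apply/eqP/nP/semicentral_idem.
Qed.

End SemicentralIdempotents.

(** For the direct implication, test the inclusion of torsion classes on the
    module eB, which contains e. *)
Lemma idempotent_otp_le (A : pzRingType) (An : noetherian (A^c)^o)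
    (x y : semicentral A^c) :
  otp_le (idempotent_otp An (semicentralP x)) (idempotent_otp An (semicentralP y))
  <-> semicentral_le x y.
Proof.
split=> [xy|/eqP xy X /= Xx z]; last by rewrite -[z]Xx scalerA xy.
have [N [i [i_inj iP]]] :=
  submodule_object (semicentral_fixed_submodule (semicentralP x) (A^c)^o).
have Nfg := finitely_generated_injection An i_inj (regular_finitely_generated _).
have /iP[z zE] : val x *: (val x : (A^c)^o) = val x by apply: semicentral_idem.
have Ny : val y *: z = z.
  apply: (xy (FgMod Nfg)) => {zE}z /=; apply: i_inj; rewrite linearZ /=.
  by apply/iP; exists z.
by apply/eqP; rewrite -zE -[_ * _]linearZ /= Ny.
Qed.

(* In MathComp a nonempty finite distributive lattice is a
   [finTBDistrLatticeType]; f is an isomorphism of posets. *)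
Theorem corollary2p10 (A : pzRingType) (hA : artin_algebra A) :
  exists (d : Order.disp_t) (L : finTBDistrLatticeType d)
    (f : L -> omega_torsion_pair A),
    bijective f /\ (forall x y : L, (x <= y)%O <-> otp_le (f x) (f y)).
Proof.
have An := artin_algebra_noetherian hA.
have [d [L [r [r_le r_surj]]]] := finite_distributive_quotient
  (@semicentral_le_refl A^c) (@semicentral_le_trans _) (@semicentral_le_meet _)
  (@semicentral_join_le _) (@semicentral_meet_join _) (@semicentral_bot_le _)
  (@semicentral_le_top _) (semicentral_min An) (semicentral_max An).
pose f x := idempotent_otp An (semicentralP (r x)).
have f_le x y : (x <= y)%O <-> otp_le (f x) (f y).
  by rewrite r_le; apply: iff_sym; apply: idempotent_otp_le.
have /choice[g gP] (o : omega_torsion_pair A) : exists x, f x = o.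
  have [e [eC eP]] := otp_semicentral_idempotent An o hA.
  have [x /andP[/eqP ex /eqP xe]] := r_surj (mk_semicentral eC).
  rewrite /= in ex xe; exists x; apply: otp_eq => X.
    rewrite (eP X).1; split=> /= h z.
      by rewrite -[z]h scalerA xe.
    by rewrite -[z]h scalerA ex.
  rewrite (eP X).2; split=> /= h z.
    by rewrite -ex -scalerA h.
  by rewrite -xe -scalerA h.
exists d, L, f; split=> //; exists g => // x.
by apply: le_anti; apply/andP; split; apply/f_le => X; rewrite gP.
Qed.
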